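(* Let $Q=Q_0+sQ_1$ with $Q_0,Q_1\in\mathbb{H}[t]$ and $Q_1$ monic, let $\gcd(Q)=1$, and suppose $QQ^\ast=PR$ with $P\in\mathbb{R}[t]$ and $R\in\mathbb{R}[s]$. Then all elements of $\mathrm{Fact}(Q)$ can be obtained by repeated application of left and right jumps of the $s$-factor; that is, starting from any given element of $\mathrm{Fact}(Q)$, every element of $\mathrm{Fact}(Q)$ is reached by a finite (possibly empty) sequence of left and right jumps.
   Context: $\mathbb{H}$ is the skew field of real quaternions with units $\mathbf{i},\mathbf{j},\mathbf{k}$; $\mathbb{H}[t,s]$ is the ring of polynomials in which $t,s$ commute with each other and with all coefficients. $Q^\ast$ is obtained by conjugating all coefficients. $\gcd(Q)$ is the monic greatest common divisor in $\mathbb{R}[t,s]$ of the four real coordinate polynomials of $Q$ with respect to $1,\mathbf{i},\mathbf{j},\mathbf{k}$. $\mathrm{fact}(Q)$ is the set of all factorizations $Q=(t-h_1)\cdots(t-h_n)(s-h)(t-k_1)\cdots(t-k_m)$ with $n,m\ge0$ and $h_i,h,k_j\in\mathbb{H}$ (an element is the tuple of linear factors; empty products equal $1$). Two elements of $\mathrm{fact}(Q)$ with left $t$-factors $t-h_1,\dots,t-h_n$ and $t-\hat h_1,\dots,t-\hat h_l$ (the factors to the left of the $s$-factor) are equivalent if $\prod_{i=1}^{n}(t-h_i)(t-h_i)^\ast=\prod_{i=1}^{l}(t-\hat h_i)(t-\hat h_i)^\ast$. $\mathrm{Fact}(Q)$ is the set of equivalence classes. Jumps: if a class in $\mathrm{Fact}(Q)$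 has a representative $(t-h_1)\cdots(t-h_n)(s-h)(t-k_1)\cdots(t-k_m)$ with $n\ge1$ in which $t-h_n$ and $s-h$ commute, then the transition from this class to the class of $(t-h_1)\cdots(t-h_{n-1})(s-h)(t-h_n)(t-k_1)\cdots(t-k_m)$ is called a left jump of the $s$-factor. If a class has a representative with $m\ge1$ in which $s-h$ and $t-k_1$ commute, then the transition to the class of $(t-h_1)\cdots(t-h_n)(t-k_1)(s-h)(t-k_2)\cdots(t-k_m)$ is called a right jump of the $s$-factor. *)

(* Defs.v *)
From HB Require Import structures.
From Stdlib Require Import Relation_Operators.
From mathcomp Require Import all_boot all_order all_algebra.
From mathcomp Require Import ring.
From mathcomp Require Import classical_sets reals.

Set Implicit Arguments.
Unset Strict Implicit.
Unset Printing Implicit Defensive.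

Import GRing.Theory.
Local Open Scope ring_scope.

(* Hamilton quaternions a + b i + c j + d k, with i^2 = j^2 = k^2 = ijk = -1. *)

Record quat (R : Type) : Type := Quat { q1 : R; qi : R; qj : R; qk : R }.

Definition quat_tuple (R : Type) (x : quat R) : R * R * R * R :=
  (q1 x, qi x, qj x, qk x).
Definition tuple_quat (R : Type) (u : R * R * R * R) : quat R :=
  let: (a, b, c, d) := u in Quat a b c d.
Lemma quat_tupleK (R : Type) : cancel (@quat_tuple R) (@tuple_quat R).
Proof. by case. Qed.

HB.instance Definition _ (R : choiceType) :=
  Choice.copy (quat R) (can_type (@quat_tupleK R)).

Section QuaternionRing.
Variable R : comNzRingType.
Implicit Types x y z : quat R.

Definition quat_add x y :=
  Quat (q1 x + q1 y) (qi x + qi y) (qj x + qj y) (qk x + qk y).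
Definition quat_opp x := Quat (- q1 x) (- qi x) (- qj x) (- qk x).
Definition quat_mul x y :=
  Quat (q1 x * q1 y - qi x * qi y - qj x * qj y - qk x * qk y)
       (q1 x * qi y + qi x * q1 y + qj x * qk y - qk x * qj y)
       (q1 x * qj y - qi x * qk y + qj x * q1 y + qk x * qi y)
       (q1 x * qk y + qi x * qj y - qj x * qi y + qk x * q1 y).

Lemma quat_addA : associative quat_add.
Proof. by move=> x y z; rewrite /quat_add /=; congr Quat; ring. Qed.
Lemma quat_addC : commutative quat_add.
Proof. by move=> x y; rewrite /quat_add /=; congr Quat; ring. Qed.
Lemma quat_add0 : left_id (Quat 0 0 0 0) quat_add.
Proof. by case=> a b c d; rewrite /quat_add /=; congr Quat; ring. Qed.
Lemma quat_addN : left_inverse (Quat 0 0 0 0) quat_opp quat_add.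
Proof. by move=> x; rewrite /quat_add /=; congr Quat; ring. Qed.

HB.instance Definition _ := GRing.isZmodule.Build (quat R)
  quat_addA quat_addC quat_add0 quat_addN.

Lemma quat_mulA : associative quat_mul.
Proof. by move=> x y z; rewrite /quat_mul /=; congr Quat; ring. Qed.
Lemma quat_mul1l : left_id (Quat 1 0 0 0) quat_mul.
Proof. by case=> a b c d; rewrite /quat_mul /=; congr Quat; ring. Qed.
Lemma quat_mul1r : right_id (Quat 1 0 0 0) quat_mul.
Proof. by case=> a b c d; rewrite /quat_mul /=; congr Quat; ring. Qed.
Lemma quat_mulDl : left_distributive quat_mul quat_add.
Proof. by move=> x y z; rewrite /quat_mul /quat_add /=; congr Quat; ring. Qed.
Lemma quat_mulDr : right_distributive quat_mul quat_add.
Proof. by move=> x y z; rewrite /quat_mul /quat_add /=; congr Quat; ring. Qed.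
Lemma quat_1_neq0 : Quat 1 0 0 0 != 0 :> quat R.
Proof. by apply/eqP=> -[] /eqP; rewrite oner_eq0. Qed.

HB.instance Definition _ := GRing.Zmodule_isNzRing.Build (quat R)
  quat_mulA quat_mul1l quat_mul1r quat_mulDl quat_mulDr quat_1_neq0.

Definition quat_conj x : quat R := Quat (q1 x) (- qi x) (- qj x) (- qk x).
Definition quat_real (a : R) : quat R := Quat a 0 0 0.

End QuaternionRing.

(* H[t,s] is {poly {poly (quat R)}} and R[t,s] is {poly {poly R}}: the inner
   indeterminate is t, the outer one is s. *)
Section Bivariate.
Variable R : realType.

Local Notation H := (quat R).
Local Notation Hts := {poly {poly H}}.
Local Notation Rts := {poly {poly R}}.

Definition tlin (h : H) : Hts := ('X - h%:P)%:P.
Definition slin (h : H) : Hts := 'X - h%:P%:P.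

Definition polyconj (Q : Hts) : Hts :=
  map_poly (map_poly (@quat_conj R)) Q.

(* The embeddings of R[t] and R[s] into H[t,s]. *)
Definition real_t (P : {poly R}) : Hts := (map_poly (@quat_real R) P)%:P.
Definition real_s (P : {poly R}) : Hts :=
  map_poly (fun a => (quat_real a)%:P) P.

Definition coord (f : H -> R) (Q : Hts) : Rts :=
  map_poly (map_poly f) Q.
Definition coords (Q : Hts) : seq Rts :=
  [:: coord (@q1 R) Q; coord (@qi R) Q; coord (@qj R) Q; coord (@qk R) Q].

(* Polydiv's [%|] and [gcdp] on {poly {poly R}} are pseudo-division notions
   (they ignore factors in R[t]), so divisibility in R[t,s] is spelled out. *)
Definition divides (d a : Rts) : Prop := exists c, a = c * d.

(* Monic is meant for the lexicographic order with s > t; the gcd is only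
   determined up to a nonzero real constant, so the order is immaterial. *)
Definition is_gcd (Q : Hts) (d : Rts) : Prop :=
  [/\ lead_coef (lead_coef d) = 1,
      forall a, a \in coords Q -> divides d a
    & forall e, (forall a, a \in coords Q -> divides e a) -> divides e d].

(* (t - h_1)...(t - h_n) (s - h) (t - k_1)...(t - k_m) *)
Record factorization : Type := Factorization
  { tleft : seq H; sroot : H; tright : seq H }.

Definition fprod (f : factorization) : Hts :=
  (\prod_(h <- tleft f) tlin h) * slin (sroot f)
  * (\prod_(k <- tright f) tlin k).

Local Open Scope classical_set_scope.

Definition fact_set (Q : Hts) : set factorization :=
  [set f | fprod f = Q].

Definition fact_equiv (f g : factorization) : Prop :=
  \prod_(h <- tleft f) (tlin h * polyconj (tlin h)) =
  \prod_(h <- tleft g) (tlin h * polyconj (tlin h)).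

Definition fact_class (Q : Hts) (f : factorization) : set factorization :=
  [set g | fact_set Q g /\ fact_equiv f g].

Definition Fact (Q : Hts) : set (set factorization) :=
  [set fact_class Q f | f in fact_set Q].

Definition left_jump (Q : Hts) (C D : set factorization) : Prop :=
  exists (hs : seq H) (hn h : H) (ks : seq H),
    [/\ Fact Q C,
        C (Factorization (rcons hs hn) h ks),
        GRing.comm (tlin hn) (slin h)
      & D = fact_class Q (Factorization hs h (hn :: ks))].

Definition right_jump (Q : Hts) (C D : set factorization) : Prop :=
  exists (hs : seq H) (h k1 : H) (ks : seq H),
    [/\ Fact Q C,
        C (Factorization hs h (k1 :: ks)),
        GRing.comm (slin h) (tlin k1)
      & D = fact_class Q (Factorization (rcons hs k1) h ks)].

Definition jump (Q : Hts) (C D : set factorization) : Prop :=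
  left_jump Q C D \/ right_jump Q C D.

Definition jumps (Q : Hts) :
    set factorization -> set factorization -> Prop :=
  clos_refl_trans (set factorization) (jump Q).

End Bivariate.

(* Main.v *)
(** Write a factorization as A (s - h) B with norm N(A) = A A^*, and let
    A' (s - h') B' be another one.  Comparing coefficients of s gives A B = A' B'
    and A h B = A' h' B', whence N(A') A h A^* = N(A) A' h' A'^*.  If a quadratic
    M occurs more often among the norms of the linear factors of A than among
    those of A', then M divides A h A^*.  As gcd(Q) = 1, no such M divides A, so
    the factors of A can be reordered until the last one, t - x, has norm M, and
    then M | A h A^* forces x h = h x.  Hence a left jump moves t - x past s - h.
    Jumping in this way from whichever factorization has the excess, both meet
    in a common class after finitely many steps, and left and right jumps are
    inverse to each other. *)

From HB Require Import structures.
From Stdlib Require Import Relation_Operators.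
Require Import Defs.
From mathcomp Require Import all_boot all_order all_algebra.
From mathcomp Require Import ring lra.
From mathcomp Require Import classical_sets reals.
Import GRing.Theory Num.Theory.
Local Open Scope ring_scope.

Set Implicit Arguments.
Unset Strict Implicit.

(** * Quaternion conjugation, norm and inverse *)

Lemma quatP (R : comNzRingType) (x y : quat R) :
  q1 x = q1 y -> qi x = qi y -> qj x = qj y -> qk x = qk y -> x = y.
Proof. by case: x y => [a b c d] [a' b' c' d'] /= -> -> -> ->. Qed.

Lemma quat_addE (R : comNzRingType) (x y : quat R) : x + y = quat_add x y.
Proof. by []. Qed.

Lemma quat_oppE (R : comNzRingType) (x : quat R) : - x = quat_opp x.
Proof. by []. Qed.

Lemma quat_mulE (R : comNzRingType) (x y : quat R) : x * y = quat_mul x y.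
Proof. by []. Qed.

Lemma quat_0E (R : comNzRingType) : 0 = Quat 0 0 0 0 :> quat R.
Proof. by []. Qed.

Lemma quat_1E (R : comNzRingType) : 1 = Quat 1 0 0 0 :> quat R.
Proof. by []. Qed.

Ltac quat_ring :=
  apply: quatP;
  rewrite ?quat_addE ?quat_oppE ?quat_mulE ?quat_0E ?quat_1E /=; ring.

Lemma quat_real_zmod_morphism (R : comNzRingType) : zmod_morphism (@quat_real R).
Proof. by move=> a b; quat_ring. Qed.

Lemma quat_real_monoid_morphism (R : comNzRingType) :
  monoid_morphism (@quat_real R).
Proof. by split=> [|a b]; quat_ring. Qed.

HB.instance Definition _ (R : comNzRingType) :=
  GRing.isZmodMorphism.Build R (quat R) (@quat_real R)
    (@quat_real_zmod_morphism R).
HB.instance Definition _ (R : comNzRingType) :=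
  GRing.isMonoidMorphism.Build R (quat R) (@quat_real R)
    (@quat_real_monoid_morphism R).

Lemma quat_conj_zmod_morphism (R : comNzRingType) : zmod_morphism (@quat_conj R).
Proof. by move=> a b; quat_ring. Qed.

HB.instance Definition _ (R : comNzRingType) :=
  GRing.isZmodMorphism.Build (quat R) (quat R) (@quat_conj R)
    (@quat_conj_zmod_morphism R).

Lemma quat_conjM (R : comNzRingType) (x y : quat R) :
  quat_conj (x * y) = quat_conj y * quat_conj x.
Proof. by quat_ring. Qed.

Lemma quat_conjK (R : comNzRingType) : involutive (@quat_conj R).
Proof. by move=> x; quat_ring. Qed.

Lemma quat_realC (R : comNzRingType) (a : R) (x : quat R) :
  quat_real a * x = x * quat_real a.
Proof. by quat_ring. Qed.

Definition quat_norm (R : comNzRingType) (x : quat R) : R :=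
  q1 x ^+ 2 + qi x ^+ 2 + qj x ^+ 2 + qk x ^+ 2.

Lemma quat_mul_conj (R : comNzRingType) (x : quat R) :
  x * quat_conj x = quat_real (quat_norm x).
Proof. by rewrite /quat_norm; quat_ring. Qed.

Lemma quat_conj_mul (R : comNzRingType) (x : quat R) :
  quat_conj x * x = quat_real (quat_norm x).
Proof. by rewrite /quat_norm; quat_ring. Qed.

Lemma sqr_le0 (R : realFieldType) (u : R) : u * u <= 0 -> u = 0.
Proof. by move=> u0; apply/eqP; rewrite -[_ == _]orbb -mulf_eq0; apply/eqP; nra. Qed.

Lemma quat_norm_eq0 (R : realFieldType) (x : quat R) :
  (quat_norm x == 0) = (x == 0).
Proof.
apply/eqP/eqP => [|->]; last by rewrite /quat_norm quat_0E /= !expr0n /= !addr0.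
case: x => a b c d; rewrite /quat_norm /= => E.
by rewrite quat_0E; congr Quat; apply: sqr_le0; nra.
Qed.

Definition quat_inv (R : realFieldType) (x : quat R) : quat R :=
  quat_real (quat_norm x)^-1 * quat_conj x.

Lemma quat_mulV (R : realFieldType) (x : quat R) : x != 0 -> x * quat_inv x = 1.
Proof.
move=> x0; rewrite /quat_inv mulrA -quat_realC -mulrA quat_mul_conj -rmorphM.
by rewrite mulVf ?rmorph1 ?quat_norm_eq0.
Qed.

Lemma quat_mulVl (R : realFieldType) (x : quat R) : x != 0 -> quat_inv x * x = 1.
Proof.
move=> x0; rewrite /quat_inv -mulrA quat_conj_mul -rmorphM.
by rewrite mulVf ?rmorph1 ?quat_norm_eq0.
Qed.

Lemma quat_conj_eq0 (R : comNzRingType) (x : quat R) :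
  (quat_conj x == 0) = (x == 0).
Proof. by rewrite -(inj_eq (inv_inj (@quat_conjK R))) raddf0 quat_conjK. Qed.

(** * Linear factors, real polynomials and conjugation in H[t] *)

(* Locked: otherwise failed matches of products unfold polynomial arithmetic. *)
HB.lock Definition lin (R : comNzRingType) (h : quat R) : {poly (quat R)} :=
  'X - h%:P.

Lemma linE (R : comNzRingType) (h : quat R) : lin h = 'X - h%:P.
Proof. by rewrite lin.unlock. Qed.

Lemma lin_monic (R : comNzRingType) (h : quat R) : lin h \is monic.
Proof. by rewrite linE monicXsubC. Qed.

Definition rpoly (R : comNzRingType) (p : {poly R}) : {poly (quat R)} :=
  map_poly (@quat_real R) p.

HB.instance Definition _ (R : comNzRingType) :=
  GRing.RMorphism.copy (@rpoly R) (map_poly (@quat_real R)).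

Definition pconj (R : comNzRingType) (p : {poly (quat R)}) : {poly (quat R)} :=
  map_poly (@quat_conj R) p.

HB.instance Definition _ (R : comNzRingType) :=
  GRing.Additive.copy (@pconj R) (map_poly (@quat_conj R)).

Lemma rpolyC (R : comNzRingType) (p : {poly R}) (x : {poly (quat R)}) :
  rpoly p * x = x * rpoly p.
Proof.
apply/polyP=> i; rewrite coefM coefMr; apply: eq_bigr => j _.
by rewrite coef_map quat_realC.
Qed.

Lemma pconjM (R : comNzRingType) (x y : {poly (quat R)}) :
  pconj (x * y) = pconj y * pconj x.
Proof.
apply/polyP=> i; rewrite coef_map coefM coefMr raddf_sum; apply: eq_bigr => j _.
by rewrite /= !coef_map quat_conjM.
Qed.

Lemma pconjC (R : comNzRingType) (c : quat R) : pconj c%:P = (quat_conj c)%:P.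
Proof. exact: map_polyC. Qed.

Lemma pconj_lin (R : comNzRingType) (h : quat R) :
  pconj (lin h) = lin (quat_conj h).
Proof.
rewrite !linE raddfB /= pconjC; congr (_ - _); apply/polyP => i.
by rewrite coef_map coefX; case: (i == 1)%N; rewrite ?raddf0 //; quat_ring.
Qed.

Lemma pconj_rpoly (R : comNzRingType) (p : {poly R}) : pconj (rpoly p) = rpoly p.
Proof. by apply/polyP => i; rewrite !coef_map; quat_ring. Qed.

(** * The real quadratic norms (t - h)(t - h)^* of linear factors *)

Definition nrm (R : comNzRingType) (h : quat R) : {poly R} :=
  'X^2 - (q1 h *+ 2)%:P * 'X + (quat_norm h)%:P.

Lemma mulBB_comm (T : pzRingType) (x a b : T) : GRing.comm x b ->
  (x - a) * (x - b) = x ^+ 2 - (a + b) * x + a * b.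
Proof.
by move=> xb; rewrite mulrBl !mulrBr mulrDl opprD opprK xb expr2 opprD !addrA
  [x * x - _ - _]addrAC.
Qed.

Lemma lin_mul (R : comNzRingType) (h k : quat R) :
  lin h * lin k = 'X^2 - (h + k)%:P * 'X + (h * k)%:P.
Proof.
by rewrite !linE polyCD polyCM; apply: mulBB_comm; rewrite /GRing.comm commr_polyX.
Qed.

Lemma lin_mul_eq (R : comNzRingType) (h k h' k' : quat R) :
  h + k = h' + k' -> h * k = h' * k' -> lin h * lin k = lin h' * lin k'.
Proof. by move=> sE pE; rewrite (lin_mul h k) (lin_mul h' k') sE pE. Qed.

Lemma lin_conj (R : comNzRingType) (h : quat R) :
  lin h * lin (quat_conj h) = rpoly (nrm h).
Proof.
have -> : nrm h = 'X * 'X - (q1 h *+ 2)%:P * 'X + (quat_norm h)%:P by [].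
rewrite lin_mul quat_mul_conj expr2 /rpoly [RHS]rmorphD [in RHS]rmorphB !rmorphM.
rewrite /= map_polyX !map_polyC /=.
have -> // : h + quat_conj h = quat_real (q1 h *+ 2) by rewrite mulr2n; quat_ring.
Qed.

Lemma nrm_conj (R : comNzRingType) (h : quat R) : nrm (quat_conj h) = nrm h.
Proof. by rewrite /nrm /quat_norm /= !sqrrN. Qed.

Lemma lin_conjl (R : comNzRingType) (h : quat R) :
  lin (quat_conj h) * lin h = rpoly (nrm h).
Proof. by have := lin_conj (quat_conj h); rewrite quat_conjK nrm_conj. Qed.

(** The value of [nrm h] at a real [r] is the squared length of h - r, a sum of four squares. *)
Lemma nrm_root (R : realFieldType) (h : quat R) (r : R) :
  root (nrm h) r -> h = quat_real r.
Proof.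
rewrite /root /nrm !hornerE /quat_norm; case: h => a b c d /= /eqP E.
have := (sqr_ge0 (a - r), sqr_ge0 b, sqr_ge0 c, sqr_ge0 d) => -[[[ra rb] rc] rd].
by apply: quatP => /=; first (apply/eqP; rewrite -subr_eq0; apply/eqP);
   apply: sqr_le0; lra.
Qed.

(** Two distinct monic quadratics differ by a polynomial of degree at most 1, so a nonconstant
    common divisor would be linear; by [nrm_root] its real root would equal both [h] and [k]. *)
Lemma nrm_coprime (R : realFieldType) (h k : quat R) :
  nrm h != nrm k -> coprimep (nrm h) (nrm k).
Proof.
move=> neq; rewrite /coprimep; set g := gcdp _ _.
have gh : g %| nrm h by rewrite dvdp_gcdl.
have gk : g %| nrm k by rewrite dvdp_gcdr.
have gd : g %| nrm h - nrm k by rewrite dvdp_sub.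
have d0 : nrm h - nrm k != 0 by rewrite subr_eq0.
have sz : (size (nrm h - nrm k)%R <= 2)%N.
  have -> : nrm h - nrm k =
      (q1 k *+ 2 - q1 h *+ 2)%:P * 'X + (quat_norm h - quat_norm k)%:P.
    by rewrite /nrm !polyCB; ring.
  by rewrite size_MXaddC; case: ifP => // _; rewrite ltnS size_polyC_leq1.
have g0 : g != 0 by apply: contraNneq d0 => g0; rewrite g0 dvd0p in gd.
have := leq_trans (dvdp_leq d0 gd) sz; rewrite leq_eqVlt ltnS => /orP[/eqP g2|].
  have [r] := poly2_root g2; rewrite -dvdp_XsubCl => gr.
  have hr : h = quat_real r by apply: nrm_root; rewrite -dvdp_XsubCl (dvdp_trans gr).
  have kr : k = quat_real r by apply: nrm_root; rewrite -dvdp_XsubCl (dvdp_trans gr).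
  by rewrite hr kr eqxx in neq.
by rewrite eqn_leq => ->; rewrite size_poly_gt0.
Qed.

Lemma nrmE (R : comNzRingType) (h : quat R) :
  nrm h = 'X^2 + (- (q1 h *+ 2)%:P * 'X + (quat_norm h)%:P).
Proof. by rewrite /nrm mulNr addrA. Qed.

Lemma size_nrm (R : comNzRingType) (h : quat R) : size (nrm h) = 3.
Proof.
rewrite nrmE size_polyDl size_polyXn // -polyCN size_MXaddC.
by case: ifP => // _; rewrite !ltnS size_polyC_leq1.
Qed.

Lemma rpoly_nrm_monic (R : comNzRingType) (h : quat R) : rpoly (nrm h) \is monic.
Proof. by rewrite -lin_conj monicMl ?lin_monic. Qed.

Lemma prod_lin_monic (R : comNzRingType) (s : seq (quat R)) :
  \prod_(h <- s) lin h \is monic.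
Proof. by apply: rpred_prod => h _; apply: lin_monic. Qed.

Lemma monic_lreg (R : nzRingType) (p : {poly R}) : p \is monic -> GRing.lreg p.
Proof. by move/monicP=> mp; apply: lreg_lead; rewrite mp; apply: lreg1. Qed.

Lemma monic_rreg (R : nzRingType) (p : {poly R}) : p \is monic -> GRing.rreg p.
Proof. by move/monicP=> mp; apply: rreg_lead; rewrite mp; apply: rreg1. Qed.

Lemma prod_lin_pconj (R : comNzRingType) (s : seq (quat R)) :
  (\prod_(h <- s) lin h) * pconj (\prod_(h <- s) lin h) =
    rpoly (\prod_(h <- s) nrm h).
Proof.
elim: s => [|h s IH].
  rewrite !big_nil mul1r /rpoly rmorph1 -polyC1 pconjC.
  by congr (_%:P); quat_ring.
rewrite !big_cons pconjM -mulrA [_ * (pconj _ * _)]mulrA IH pconj_lin.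
by rewrite rpolyC mulrA lin_conj /rpoly rmorphM.
Qed.

(** Follows from the other order by cancelling A on the left in A A^* A = N(A) A = A N(A). *)
Lemma prod_lin_pconjl (R : comNzRingType) (s : seq (quat R)) :
  pconj (\prod_(h <- s) lin h) * (\prod_(h <- s) lin h) =
    rpoly (\prod_(h <- s) nrm h).
Proof.
apply: (monic_lreg (prod_lin_monic s)).
by rewrite mulrA prod_lin_pconj rpolyC.
Qed.

(** * Reordering linear factors *)

Lemma quat_normM (R : comNzRingType) (x y : quat R) :
  quat_norm (x * y) = quat_norm x * quat_norm y.
Proof. by rewrite /quat_norm quat_mulE /=; ring. Qed.

Lemma q1_mulC (R : comNzRingType) (x y : quat R) : q1 (x * y) = q1 (y * x).
Proof. by rewrite !quat_mulE /=; ring. Qed.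

(** Matching coefficients asks for k' + h' = h + k and k' h' = h k. If h' has the real part and norm
    of h, then h'^2 = 2 Re(h) h' - |h|^2, and eliminating k' turns the second equation into w h' = h
    w with w = k - h^*. So h' = w^-1 h w, which makes sense unless k = h^*. *)
Lemma lin_swap (R : realFieldType) (h k : quat R) : k != quat_conj h ->
  exists h' k', [/\ lin h * lin k = lin k' * lin h', nrm h' = nrm h
                  & nrm k' = nrm k].
Proof.
rewrite -subr_eq0; set w := k - _ => w0.
pose h' := quat_inv w * (h * w); pose k' := h + k - h'.
have wh : w * h' = h * w by rewrite mulrA quat_mulV // mul1r.
have re : q1 h' = q1 h by rewrite q1_mulC -mulrA quat_mulV // mulr1.
have no : quat_norm h' = quat_norm h.
  by rewrite quat_normM mulrC -quat_normM -mulrA quat_mulV // mulr1.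
have kh : k' * h' = h * k.
  (* An identity valid for every [x]; its three error terms vanish at [h'], by the relation with [w]
     and the equality of real parts and norms. *)
  have -> (x : quat R) : (h + k - x) * x = h * k + (w * x - h * w)
      + (quat_real (q1 h *+ 2 - q1 x *+ 2) * x
         + quat_real (quat_norm x - quat_norm h)).
    by rewrite /w /quat_norm !mulr2n; quat_ring.
  by rewrite wh re no !subrr raddf0 mul0r !addr0.
have sk : k' + h' = h + k by rewrite subrK.
exists h', k'; split; first exact: lin_mul_eq (esym sk) (esym kh).
  by rewrite /nrm re no.
have k1 : q1 k' = q1 k.
  have : q1 k' + q1 h' = q1 h + q1 k := congr1 (@q1 R) sk.
  by rewrite re addrC => /addrI.
suff k2 : quat_norm k' = quat_norm k by rewrite /nrm k1 k2.
(* The norm of [k'] comes from multiplicativity in [k' * h' = h * k] by cancelling the norm of [h],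
   so [h = 0] is treated apart. *)
have [h0|h0] := eqVneq h 0; first by rewrite /k' /h' h0 mul0r mulr0 subr0 add0r.
have n0 : quat_norm h != 0 by rewrite quat_norm_eq0.
by apply: (mulIf n0); rewrite -{1}no -quat_normM kh quat_normM mulrC.
Qed.

(** [lin_swap] moves the factor to the right one place at a time. It fails only at a neighbour
    [quat_conj h], where the two factors would multiply to the central polynomial [nrm h], against
    the hypothesis; the hypothesis survives each swap because the product does not change. *)
Lemma lin_to_end (R : realFieldType) (h : quat R) (s2 s1 : seq (quat R)) :
  (forall m c, \prod_(x <- s1 ++ h :: s2) lin x <> rpoly (nrm m) * c) ->
  exists s x, [/\ nrm x = nrm h,
    \prod_(x <- rcons s x) lin x = \prod_(x <- s1 ++ h :: s2) lin x
    & perm_eq (map (@nrm R) (rcons s x)) (map (@nrm R) (s1 ++ h :: s2))].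
Proof.
elim: s2 h s1 => [|k s2 IH] h s1 ndiv.
  by exists s1, h; rewrite cats1.
have kh : k != quat_conj h.
  apply/eqP => kh; apply: (ndiv h (\prod_(x <- s1 ++ s2) lin x)).
  by rewrite !big_cat !big_cons /= kh [lin h * _]mulrA lin_conj mulrA -rpolyC mulrA.
have [h' [k' [E nh nk]]] := lin_swap kh.
have E' : \prod_(x <- rcons s1 k' ++ h' :: s2) lin x =
          \prod_(x <- s1 ++ h :: k :: s2) lin x.
  by rewrite cat_rcons !big_cat !big_cons /= !(mulrA (lin _) (lin _)) E.
have [|s [x [nx px perm]]] := IH h' (rcons s1 k'); first by rewrite E'.
exists s, x; split; [by rewrite nx|by rewrite px|].
apply: perm_trans perm _; rewrite cat_rcons !map_cat perm_cat2l /= nh nk.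
by rewrite (perm_catCA [:: _] [:: _]).
Qed.

(** * Commutation from divisibility by a norm *)

Lemma lin_mul_const (R : comNzRingType) (a c : quat R) (d : {poly (quat R)}) :
  c%:P = lin a * d -> c = 0.
Proof.
have [-> /eqP|d0] := eqVneq d 0; first by rewrite mulr0 polyC_eq0 => /eqP.
move=> E; have := size_polyC_leq1 c.
rewrite E size_monicM ?lin_monic // linE size_XsubC /= ltnS leqn0.
by rewrite size_poly_eq0 (negPf d0).
Qed.

(** The names [pa], [pu], [pq] stand for conjugates. Replacing [a] by its remainder [u] modulo a
    central [m] keeps a h a^* divisible by m. *)
Lemma remainder_norm (T : pzRingType) (m a u q h pa pq pu d : T) :
  (forall z, m * z = z * m) -> m * q = a - u -> a * h * pa = m * d ->
  pq * m = pa - pu -> u * h * pu = m * (d - q * h * pa - u * h * pq).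
Proof.
move=> mC mq ahpa pqm.
have mr : m * (u * h * pq) = u * h * (pa - pu) by rewrite -pqm mC !mulrA.
by rewrite !mulrBr mr -ahpa !mulrA mq !mulrBl mulrBr subKr subKr.
Qed.

Lemma central_unit_cancel (T : pzRingType) (m c c' i i' y e : T) :
  (forall z, m * z = z * m) -> c * y * c' = m * e -> i * c = 1 -> c' * i' = 1 ->
  y = m * (i * e * i').
Proof.
move=> mC E ic ci; rewrite !mulrA mC -(mulrA i) -E -!mulrA ci mulr1.
by rewrite mulrA ic mul1r.
Qed.

Lemma mulB_commutator (T : pzRingType) (x a h e : T) : GRing.comm x h ->
  h * (x - a) = (x - a) * e -> a * h - h * a = (x - a) * (e - h).
Proof.
move=> xh E; rewrite [RHS]mulrBr -E mulrBr mulrBl xh opprB [RHS]addrC.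
by rewrite addrA subrK.
Qed.

(* Modulo the norm M of t - x, a multiple of t - x is c (t - x) with c constant;
   c is invertible because M does not divide the multiple, so M divides
   (t - x) h (t - x)^*. *)
Lemma comm_of_norm_dvd (R : realFieldType) (A1 d : {poly (quat R)}) (x h : quat R) :
  (forall c, A1 * lin x <> rpoly (nrm x) * c) ->
  A1 * lin x * h%:P * pconj (A1 * lin x) = rpoly (nrm x) * d ->
  x * h = h * x.
Proof.
set M := rpoly (nrm x) => ndiv E.
(* The remainder of [A1] on right division by t - x^*; multiplying the divisor by t - x on the right
   then produces M. *)
pose c := A1.[quat_conj x].
have /factor_theorem [q qE] : root (A1 - c%:P) (quat_conj x).
  by rewrite /root hornerD hornerN hornerC subrr.
have AE : A1 * lin x = M * q + c%:P * lin x.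
  rewrite -[A1](subrK c%:P) qE mulrDl -mulrA -linE lin_conjl.
  by rewrite -rpolyC.
have c0 : c != 0.
  by apply/eqP => c0; apply: (ndiv q); rewrite AE c0 mul0r addr0.
have [e eE] : exists e,
    c%:P * (lin x * h%:P * lin (quat_conj x)) * (quat_conj c)%:P = M * e.
  exists (d - q * h%:P * pconj (A1 * lin x) - c%:P * lin x * h%:P * pconj q).
  rewrite -(remainder_norm (a := A1 * lin x)
    (pu := lin (quat_conj x) * (quat_conj c)%:P)).
  - by rewrite !mulrA.
  - exact: rpolyC.
  - by rewrite AE addrK.
  - exact: E.
  rewrite -pconjC -pconj_lin -pconjM AE -[in LHS](pconj_rpoly _ : pconj M = M).
  by rewrite -pconjM raddfD addrK.
have [e' e'E] : exists e', lin x * h%:P * lin (quat_conj x) = M * e'.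
  exists ((quat_inv c)%:P * e * (quat_inv (quat_conj c))%:P).
  apply: (central_unit_cancel (rpolyC _) eE); rewrite -polyCM.
    by rewrite quat_mulVl.
  by rewrite quat_mulV ?quat_conj_eq0.
have {e'E} : h%:P * lin (quat_conj x) = lin (quat_conj x) * e'.
  by apply: (monic_lreg (lin_monic x)); rewrite !mulrA lin_conj.
move=> e'E.
have : (quat_conj x * h - h * quat_conj x)%:P = lin (quat_conj x) * (e' - h%:P).
  rewrite polyCB !polyCM linE; apply: mulB_commutator; last by rewrite -linE.
  by rewrite /GRing.comm commr_polyX.
move=> /lin_mul_const /subr0_eq.
have -> : quat_conj x = quat_real (q1 x *+ 2) - x by rewrite mulr2n; quat_ring.
by rewrite mulrBl mulrBr quat_realC => /addrI /oppr_inj.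
Qed.

(** * Comparing norm multiplicities of two factorizations *)

(** The cofactor [g] collects the norms other than [nrm x], each coprime to it by [nrm_coprime]. *)
Lemma prod_nrm_split (R : realFieldType) (x : quat R) (s : seq (quat R)) :
  exists2 g, \prod_(h <- s) nrm h = nrm x ^+ count_mem (nrm x) (map (@nrm R) s) * g
    & coprimep (nrm x) g.
Proof.
elim: s => [|h s [g E cop]]; first by exists 1; rewrite ?big_nil ?mulr1 ?coprimep1.
rewrite big_cons /= E; have [eq|neq] := eqVneq (nrm h) (nrm x).
  by exists g; rewrite // exprS eq mulrA.
exists (nrm h * g); first by rewrite add0n mulrCA.
by rewrite coprimepMr cop andbT nrm_coprime // eq_sym.
Qed.

(** Cancel [p], then multiply [X] by a Bezout relation u m + v g = 1; real polynomials are central,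
    so both summands are multiples of [m]. *)
Lemma dvd_of_coprime (R : fieldType) (m p g q r : {poly R}) (X Y : {poly (quat R)}) :
  coprimep m g -> rpoly p \is monic ->
  rpoly (p * g) * X = rpoly (p * (m * q) * r) * Y -> exists d, X = rpoly m * d.
Proof.
move=> /Bezout_eq1_coprimepP [[u v] /= E] mp.
rewrite -mulrA -(mulrA m) rmorphM rmorphM rmorphM /= -2!mulrA => /(monic_lreg mp).
rewrite -mulrA; set Z := rpoly _ * Y => EX.
exists (rpoly u * X + rpoly v * Z).
rewrite -[X in X = _]mul1r -(rmorph1 (@rpoly R)) -E rmorphD !rmorphM /=.
rewrite mulrDl mulrDr [rpoly u * rpoly m]rpolyC -!mulrA EX; congr (_ + _).
by rewrite mulrA [rpoly v * rpoly m]rpolyC -mulrA.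
Qed.

(* This is A h A^-1 = A' h' A'^-1, which follows from (A h B)(A B)^-1 =
   (A' h' B')(A' B')^-1, with denominators cleared. *)
Lemma norm_transfer_ring (T : pzRingType) (a a' b b' pa pa' m m' h h' : T) :
  (forall z, m * z = z * m) -> (forall z, m' * z = z * m') ->
  pa * a = m -> pa' * a' = m' -> a * b = a' * b' -> a * h * b = a' * h' * b' ->
  m' * (a * h * pa) * (a * b) = m * (a' * h' * pa') * (a * b).
Proof.
move=> mC mC' pam pam' E1 Eh.
have -> : m' * (a * h * pa) * (a * b) = m' * (a * h * b * m).
  by rewrite -(mulrA _ b) -mC -pam !mulrA.
have -> : m * (a' * h' * pa') * (a * b) = m * (a' * h' * b' * m').
  by rewrite E1 -(mulrA _ b') -mC' -pam' !mulrA.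
by rewrite Eh -mC -mC' !mulrA -mC.
Qed.

Lemma norm_transfer (R : realFieldType) (s s' : seq (quat R)) (B B' : {poly (quat R)})
    (h h' : quat R) (A := \prod_(x <- s) lin x) (A' := \prod_(x <- s') lin x) :
  B \is monic -> A * B = A' * B' -> A * h%:P * B = A' * h'%:P * B' ->
  rpoly (\prod_(x <- s') nrm x) * (A * h%:P * pconj A) =
  rpoly (\prod_(x <- s) nrm x) * (A' * h'%:P * pconj A').
Proof.
move=> mB E1 Eh; set F := rpoly _; set F' := rpoly _.
have mAB : A * B \is monic by rewrite monicMl ?prod_lin_monic.
apply: (monic_rreg mAB).
by apply: norm_transfer_ring E1 Eh; rewrite ?prod_lin_pconjl //; apply: rpolyC.
Qed.

Lemma comm_of_count_lt (R : realFieldType) (s s' : seq (quat R)) (x : quat R)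
    (B B' : {poly (quat R)}) (h h' : quat R)
    (A := \prod_(y <- rcons s x) lin y) (A' := \prod_(y <- s') lin y) :
  (count_mem (nrm x) (map (@nrm R) s') <
     count_mem (nrm x) (map (@nrm R) (rcons s x)))%N ->
  (forall c, A <> rpoly (nrm x) * c) ->
  B \is monic -> A * B = A' * B' -> A * h%:P * B = A' * h'%:P * B' ->
  x * h = h * x.
Proof.
move=> lt ndiv mB E1 Eh; have := norm_transfer mB E1 Eh.
have [g gE cop] := prod_nrm_split x (rcons s x).
have [g' gE' cop'] := prod_nrm_split x s'.
move: lt gE gE'; set a' := count_mem _ _; set a := count_mem _ _ => lt gE gE'.
(* The exponent [a] is written as [a'] plus a positive number: once the common power is cancelled, a
   factor [nrm x] stays on the right, while the cofactor [g'] on the left is coprime to it. *)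
rewrite -/A -/A' gE gE' -(subnKC lt) addSn -addnS exprD exprS => E.
have mx : rpoly (nrm x ^+ a') \is monic.
  by rewrite rmorphXn monic_exp ?rpoly_nrm_monic.
have [d dE] := dvd_of_coprime cop' mx E.
have AE : A = (\prod_(y <- s) lin y) * lin x by rewrite /A -cats1 big_cat big_seq1.
by apply: (@comm_of_norm_dvd _ (\prod_(y <- s) lin y) d); rewrite -AE.
Qed.

(** * Coefficients in s and real factors of Q *)

Lemma fprodE (R : realType) (f : factorization R) :
  Defs.fprod f = (\prod_(h <- tleft f) lin h)%:P * ('X - (sroot f)%:P%:P)
            * (\prod_(k <- tright f) lin k)%:P.
Proof.
rewrite /Defs.fprod /slin; congr (_ * _ * _); rewrite rmorph_prod /=;
  by apply: eq_bigr => h _; rewrite /tlin linE.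
Qed.

Lemma fprod_coefE (R : realType) (f : factorization R) :
  Defs.fprod f = ((\prod_(h <- tleft f) lin h) * (\prod_(k <- tright f) lin k))%:P * 'X
    - ((\prod_(h <- tleft f) lin h) * (sroot f)%:P
       * (\prod_(k <- tright f) lin k))%:P.
Proof.
rewrite fprodE mulrBr mulrBl -!polyCM; congr (_ - _).
by rewrite -mulrA -[X in _ * X]commr_polyX mulrA -polyCM.
Qed.

Lemma fprod_eq (R : realType) (f g : factorization R) : Defs.fprod f = Defs.fprod g ->
  (\prod_(h <- tleft f) lin h) * (\prod_(k <- tright f) lin k) =
    (\prod_(h <- tleft g) lin h) * (\prod_(k <- tright g) lin k) /\
  (\prod_(h <- tleft f) lin h) * (sroot f)%:P * (\prod_(k <- tright f) lin k) =
    (\prod_(h <- tleft g) lin h) * (sroot g)%:P * (\prod_(k <- tright g) lin k).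
Proof.
rewrite !fprod_coefE -!polyCN => E.
split; [move/(congr1 (fun p : {poly _} => p`_1)): E|
        move/(congr1 (fun p : {poly _} => p`_0)): E];
  rewrite !coefD !coefMX !coefC /=; [by rewrite !addr0|].
by rewrite !add0r => /oppr_inj.
Qed.

(** Stated for any real-linear [f], so that one proof serves all four coordinates. *)
Lemma coord_real (R : realType) (f : quat R -> R) (N : {poly R})
    (Z : {poly {poly (quat R)}}) :
  f 0 = 0 -> (forall x y, f (x + y) = f x + f y) ->
  (forall a x, f (quat_real a * x) = a * f x) ->
  Defs.coord f (real_t N * Z) = N%:P * Defs.coord f Z.
Proof.
move=> f0 fD fM; have m0 : map_poly f 0 = 0 by rewrite map_poly0.
apply/polyP=> i; rewrite coef_map_id0 // !coefCM coef_map_id0 //.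
apply/polyP=> j; rewrite coef_map_id0 // !coefM (big_morph f fD f0).
by apply: eq_bigr => k _; rewrite coef_map fM coef_map_id0.
Qed.

(** [N] divides every coordinate, hence divides 1 in R[t,s]; the coefficient of s^0 then makes [N] a
    divisor of 1 in R[t]. *)
Lemma gcd_real_factor (R : realType) (N : {poly R}) (Z : {poly {poly (quat R)}}) :
  is_gcd (real_t N * Z) 1 -> size N = 1%N.
Proof.
case=> _ _ gcd1; have [|c cE] := gcd1 N%:P.
  have dvdc f : f 0 = 0 -> (forall x y, f (x + y) = f x + f y) ->
      (forall a x, f (quat_real a * x) = a * f x) ->
      divides N%:P (Defs.coord f (real_t N * Z)).
    by move=> f0 fD fM; exists (Defs.coord f Z); rewrite coord_real // mulrC.
  move=> a; rewrite !inE => /or4P[] /eqP ->; apply: dvdc => // *;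
    by rewrite quat_mulE /=; ring.
have /(congr1 (fun p : {poly _} => p`_0)) := cE.
rewrite coefMC coefC /= => E.
by apply/eqP; rewrite -dvdp1 E dvdp_mulIr.
Qed.

(** Such a norm would be a real factor of degree 2 of the whole product, which [gcd_real_factor]
    excludes. *)
Lemma left_no_nrm_factor (R : realType) (f : factorization R) :
  is_gcd (Defs.fprod f) 1 ->
  forall m c, \prod_(h <- tleft f) lin h <> rpoly (nrm m) * c.
Proof.
move=> gcdf m c E; move: gcdf.
rewrite fprodE E polyCM -!mulrA => /gcd_real_factor.
by rewrite size_nrm.
Qed.

(** * Equivalence classes and jumps *)

Lemma fact_equivP (R : realType) (f g : factorization R) :
  fact_equiv f g <->
  rpoly (\prod_(h <- tleft f) nrm h) = rpoly (\prod_(h <- tleft g) nrm h).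
Proof.
have E (s : seq (quat R)) : \prod_(h <- s) (tlin h * polyconj (tlin h)) =
    (rpoly (\prod_(h <- s) nrm h))%:P.
  rewrite !rmorph_prod; apply: eq_bigr => h _ /=.
  rewrite -lin_conj polyCM -pconj_lin /tlin -linE; congr (_ * _).
  by rewrite /polyconj map_polyC.
by rewrite /fact_equiv !E; split=> [/polyC_inj|->].
Qed.

Lemma fact_class_eq (R : realType) (Q : {poly {poly (quat R)}})
  (f g : factorization R) : fact_equiv f g -> fact_class Q f = fact_class Q g.
Proof.
move=> /fact_equivP E; apply/seteqP; split=> x [Qx /fact_equivP Ex]; split=> //;
  by apply/fact_equivP; rewrite -Ex E.
Qed.

Lemma fact_class_refl (R : realType) (Q : {poly {poly (quat R)}})
  (f : factorization R) : fact_set Q f -> fact_class Q f f.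
Proof. by move=> Qf; split=> //; apply/fact_equivP. Qed.

Lemma mul_comm_swap (T : pzRingType) (a x y b : T) :
  GRing.comm x y -> a * x * y * b = a * y * (x * b).
Proof. by move=> xy; rewrite -(mulrA a) xy !mulrA. Qed.

Lemma fprod_jump (R : realType) (s t : seq (quat R)) (x h : quat R) :
  x * h = h * x ->
  GRing.comm (tlin x) (slin h) /\
  Defs.fprod (Factorization (rcons s x) h t) = Defs.fprod (Factorization s h (x :: t)).
Proof.
move=> xh; have polyC_comm (T : nzRingType) (u v : T) :
    u * v = v * u -> GRing.comm u%:P v%:P.
  by move=> uv; apply: etrans (esym (polyCM u v)) (etrans (congr1 _ uv) (polyCM v u)).
have cP := polyC_comm _ _ _ (esym xh).
have cX : GRing.comm h%:P ('X - x%:P) by apply: commrB cP; apply: commr_polyX.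
have cm : GRing.comm (tlin x) (slin h).
  apply: commrB; first exact: commr_polyX.
  exact: polyC_comm (esym cX).
split; first exact: cm.
rewrite /Defs.fprod /= -cats1 big_cat big_seq1 big_cons /=.
exact: mul_comm_swap.
Qed.

(** Besides the left jump, the right jump that undoes it is recorded: when the excess lies in the
    target of a chain, the chain ends with that right jump. *)
Lemma left_step (R : realType) (Q : {poly {poly (quat R)}})
    (f g : factorization R) (m : {poly R}) :
  is_gcd Q 1 -> fact_set Q f -> fact_set Q g ->
  (count_mem m (map (@nrm R) (tleft g)) <
     count_mem m (map (@nrm R) (tleft f)))%N ->
  exists f', [/\ fact_set Q f', size (tleft f) = (size (tleft f')).+1,
    left_jump Q (fact_class Q f) (fact_class Q f')
    & right_jump Q (fact_class Q f') (fact_class Q f)].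
Proof.
move=> gcdQ Qf Qg lt.
have ndiv : forall m c, \prod_(h <- tleft f) lin h <> rpoly (nrm m) * c.
  by apply: left_no_nrm_factor; rewrite Qf.
have /mapP[y yf my] : m \in map (@nrm R) (tleft f).
  by rewrite -has_pred1 has_count (leq_ltn_trans _ lt).
case: f Qf ndiv lt yf => l h r /= Qf ndiv lt yf.
have [s1 [s2 sE]] : exists s1 s2, l = s1 ++ y :: s2.
  by case/splitPr: yf => s1 s2; exists s1, s2.
have [|s [x [xy pE peq]]] := @lin_to_end R y s2 s1; first by rewrite -sE.
rewrite -sE in pE peq.
have QF : Defs.fprod (Factorization (rcons s x) h r) = Q.
  by rewrite fprodE /= pE -Qf fprodE.
have [E1 Eh] := fprod_eq (etrans QF (esym Qg)).
have xh : x * h = h * x.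
  apply: (comm_of_count_lt _ _ _ E1 Eh); last exact: prod_lin_monic.
    by rewrite xy -my (permP peq).
  by move=> c; rewrite pE; apply: ndiv.
have [cm jE] := fprod_jump s r xh.
(* Reordering permutes the norms of the left factors, so the class is unchanged and contains the
   form whose last left factor is t - x. *)
have eqv : fact_equiv (Factorization l h r) (Factorization (rcons s x) h r).
  apply/fact_equivP => /=; congr rpoly.
  by rewrite -!(big_map (@nrm R) xpredT id) (perm_big _ peq).
exists (Factorization s h (x :: r)); split=> /=.
- by rewrite /fact_set /= -jE.
- by rewrite -(size_map (@nrm R)) -(perm_size peq) size_map size_rcons.
- by exists s, x, h, r; split=> //; exists (Factorization l h r).
exists s, h, x, r; split.
- by exists (Factorization s h (x :: r)); rewrite // /fact_set /= -jE.
- by apply: fact_class_refl; rewrite /fact_set /= -jE.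
- exact: commr_sym.
by rewrite (fact_class_eq Q eqv).
Qed.

(** Induction on the total number of left t-factors. Equal multisets of norms give equal classes;
    otherwise [left_step] shortens the factorization that has more of some norm, at the start or at
    the end of the chain. *)
Lemma jumps_fact_class (R : realType) (Q : {poly {poly (quat R)}})
    (f g : factorization R) :
  is_gcd Q 1 -> fact_set Q f -> fact_set Q g ->
  jumps Q (fact_class Q f) (fact_class Q g).
Proof.
move=> gcdQ; have [n] := ubnP (size (tleft f) + size (tleft g)).
elim: n f g => // n IH f g; rewrite ltnS => le Qf Qg.
(* [perm_eq] compares counts, so its failure yields a polynomial [m] counted differently on the two
   sides. *)
have [peq|/allPn[m _ /= mE]] :=
    boolP (perm_eq (map (@nrm R) (tleft f)) (map (@nrm R) (tleft g))).
  rewrite (@fact_class_eq R Q f g); first exact: rt_refl.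
  apply/fact_equivP; congr rpoly.
  by rewrite -!(big_map (@nrm R) xpredT id) (perm_big _ peq).
case: (ltngtP (count_mem m (map (@nrm R) (tleft f)))
              (count_mem m (map (@nrm R) (tleft g)))) => [lt|lt|E].
- have [g' [Qg' sz _ jmp]] := left_step gcdQ Qg Qf lt.
  apply: rt_trans (rt_step _ _ _ _ (or_intror jmp)).
  by apply: IH => //; rewrite sz addnS in le.
- have [f' [Qf' sz jmp _]] := left_step gcdQ Qf Qg lt.
  apply: rt_trans (rt_step _ _ _ _ (or_introl jmp)) _.
  by apply: IH => //; rewrite sz addSn in le.
by rewrite E eqxx in mE.
Qed.

Unset Implicit Arguments.
Set Strict Implicit.

Theorem theorem7p6 (R : realType) (Q : {poly {poly (quat R)}})
    (Q0 Q1 : {poly (quat R)}) (P S : {poly R})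
    (defQ : Q = Q0%:P + 'X * Q1%:P) (monQ1 : Q1 \is monic)
    (gcdQ : is_gcd Q 1) (normQ : Q * polyconj Q = real_t P * real_s S)
    (C D : set (factorization R)) (FC : Fact Q C) (FD : Fact Q D) :
  jumps Q C D.
Proof.
case: FC FD => f Qf <- [g Qg <-].
exact: jumps_fact_class.
Qed.
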